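(* Let $A$ be an associative algebra over a field $K$, let $(M,\circ,\triangleright,\triangleleft,R,S)$ be an extended $A$-bimodule algebra, and let $\star:M\otimes M\to M$ be the linear map defined by $$x\star y=R(x)\triangleright y+x\triangleleft S(y)+x\circ y,\qquad x,y\in M.$$ Then $(M,\star)$ is an associative algebra if and only if, for all $x,y,z\in M$, $$(R(x)R(y)-R(x\star y))\triangleright z=x\triangleleft(S(y)S(z)-S(y\star z)).$$
   Context: All vector spaces, linear maps and tensor products are over a field $K$; associative algebras are not assumed to be unital. An $A$-bimodule $(M,\triangleright,\triangleleft)$ is a vector space $M$ with linear maps $\triangleright:A\otimes M\to M$, $\triangleleft:M\otimes A\to M$ such that $a\triangleright(b\triangleright x)=(ab)\triangleright x$, $(x\triangleleft a)\triangleleft b=x\triangleleft(ab)$, $(a\triangleright x)\triangleleft b=a\triangleright(x\triangleleft b)$ for all $a,b\in A$, $x\in M$. Extended $A$-bimodule algebra: let $A$ and $(M,\circ)$ be associative algebras and $\triangleright:A\otimes M\to M$, $\triangleleft:M\otimes A\to M$, $R,S:M\to A$ linear maps. $(M,\circ,\triangleright,\triangleleft,R,S)$ is an extended $A$-bimodule algebra if $(M,\triangleright,\triangleleft)$ is an $A$-bimodule and for all $x,y,z\in M$: $R(x)\triangleright(y\circ z)=(R(x)\triangleright y)\circ z$, $(x\circ y)\triangleleft S(z)=x\circ(y\triangleleft S(z))$, $x\circ(R(y)\triangleright z)=(x\triangleleft S(y))\circ z$. *)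

(* Defs.v *)
From HB Require Import structures.
From mathcomp Require Import all_boot all_algebra.

Set Implicit Arguments.
Unset Strict Implicit.
Unset Printing Implicit Defensive.

Import GRing.Theory.
Local Open Scope ring_scope.

(* MathComp has no non-unital associative algebras, so an algebra is a vector
   space [V] together with an explicit bilinear product, and a linear map
   [U (x) V -> W] is an element of [{bilinear U -> V -> W}]. *)
Definition is_assoc_algebra (K : fieldType) (V : lmodType K)
    (mul : {bilinear V -> V -> V}) : Prop :=
  associative mul.

Record is_bimodule (K : fieldType) (A M : lmodType K)
    (mul : {bilinear A -> A -> A})
    (actl : {bilinear A -> M -> M}) (actr : {bilinear M -> A -> M}) : Prop :=
  IsBimodule {
    bimod_actlA : forall a b x, actl a (actl b x) = actl (mul a b) x;
    bimod_actrA : forall a b x, actr (actr x a) b = actr x (mul a b);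
    bimod_actlr : forall a b x, actr (actl a x) b = actl a (actr x b)
  }.

Record is_extended_bimodule_algebra (K : fieldType) (A M : lmodType K)
    (mul : {bilinear A -> A -> A}) (circ : {bilinear M -> M -> M})
    (actl : {bilinear A -> M -> M}) (actr : {bilinear M -> A -> M})
    (R S : {linear M -> A}) : Prop :=
  IsExtendedBimoduleAlgebra {
    ext_circ_algebra : is_assoc_algebra circ;
    ext_bimodule : is_bimodule mul actl actr;
    ext_actl_circ : forall x y z,
      actl (R x) (circ y z) = circ (actl (R x) y) z;
    ext_circ_actr : forall x y z,
      actr (circ x y) (S z) = circ x (actr y (S z));
    ext_circ_act : forall x y z,
      circ x (actl (R y) z) = circ (actr x (S y)) z
  }.

Definition star (K : fieldType) (A M : lmodType K)
    (circ : {bilinear M -> M -> M})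
    (actl : {bilinear A -> M -> M}) (actr : {bilinear M -> A -> M})
    (R S : {linear M -> A}) (x y : M) : M :=
  actl (R x) y + actr x (S y) + circ x y.

Lemma star_is_bilinear (K : fieldType) (A M : lmodType K)
    (circ : {bilinear M -> M -> M})
    (actl : {bilinear A -> M -> M}) (actr : {bilinear M -> A -> M})
    (R S : {linear M -> A}) :
  bilinear_for *:%R *:%R (star circ actl actr R S).
Proof.
split=> [y a x x' | x a y y'] /=; rewrite /star.
  by rewrite (linearP R) 3!linearPl !scalerDr [RHS]addrACA; congr (_ + _);
     rewrite addrACA.
by rewrite (linearP S) 3!linearPr !scalerDr [RHS]addrACA; congr (_ + _);
   rewrite addrACA.
Qed.

HB.instance Definition _ (K : fieldType) (A M : lmodType K)
    (circ : {bilinear M -> M -> M})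
    (actl : {bilinear A -> M -> M}) (actr : {bilinear M -> A -> M})
    (R S : {linear M -> A}) :=
  bilinear_isBilinear.Build K M M M *:%R *:%R (star circ actl actr R S)
    (star_is_bilinear circ actl actr R S).

(* Main.v *)
Require Import Defs.
From HB Require Import structures.
From mathcomp Require Import all_boot all_algebra.

Set Implicit Arguments.
Unset Strict Implicit.
Unset Printing Implicit Defensive.

Import GRing.Theory.
Local Open Scope ring_scope.

(** Expanding the associator [x * (y * z) - (x * y) * z] of the product [star]
    gives seven terms on each side. The bimodule axioms and the compatibility
    axioms of an extended bimodule algebra match five terms on the left with
    five on the right, and what is left is exactly the difference of the two
    sides of the stated identity ([star_associator]). Hence one vanishes
    identically if and only if the other does. *)

Lemma star_associator (K : fieldType) (A M : lmodType K)
    (mul : {bilinear A -> A -> A}) (circ : {bilinear M -> M -> M})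
    (actl : {bilinear A -> M -> M}) (actr : {bilinear M -> A -> M})
    (R S : {linear M -> A})
    (hM : is_extended_bimodule_algebra mul circ actl actr R S) (x y z : M) :
  let st := star circ actl actr R S in
  st x (st y z) - st (st x y) z =
  actl (mul (R x) (R y) - R (st x y)) z
    - actr x (mul (S y) (S z) - S (st y z)).
Proof.
move=> st; case: hM => circA [actlA actrA actlr] actl_circ circ_actr circ_act.
(* The sum of the five terms common to both bracketings. *)
pose C := actr (actl (R x) y) (S z) + circ (actl (R x) y) z
  + circ (actr x (S y)) z + actr (circ x y) (S z) + circ (circ x y) z.
have -> : st x (st y z) =
    actl (mul (R x) (R y)) z + actr x (S (st y z)) + C.
  (* The inner product is unfolded everywhere except under [S]; below, except
     under [R]. *)
  rewrite {1}/st /star -/(st y z) {1}[st y z]/(_ + _ + _).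
  rewrite {2}[st y z]/(_ + _ + _) !linearDr /=.
  rewrite actlA -actlr actl_circ circ_act -circ_actr circA /C.
  by rewrite !addrA [LHS](ACl (1*4*2*3*5*6*7)).
have -> : st (st x y) z =
    actr x (mul (S y) (S z)) + actl (R (st x y)) z + C.
  rewrite {1}/st /star -/(st x y) {2}[st x y]/(_ + _ + _).
  rewrite {2}[st x y]/(_ + _ + _) !linearDl /=.
  rewrite actrA /C.
  by rewrite !addrA [LHS](ACl (3*1*2*5*6*4*7)).
rewrite opprD addrACA subrr addr0 linearBl linearBr /= !opprD opprK.
by rewrite [LHS](AC (2*2) (1*4*(3*2))).
Qed.

Theorem theorem3p8 (K : fieldType) (A M : lmodType K)
    (mul : {bilinear A -> A -> A}) (circ : {bilinear M -> M -> M})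
    (actl : {bilinear A -> M -> M}) (actr : {bilinear M -> A -> M})
    (R S : {linear M -> A})
    (hA : is_assoc_algebra mul)
    (hM : is_extended_bimodule_algebra mul circ actl actr R S) :
  let st := star circ actl actr R S in
  is_assoc_algebra st <->
  (forall x y z : M,
     actl (mul (R x) (R y) - R (st x y)) z =
     actr x (mul (S y) (S z) - S (st y z))).
Proof.
move=> st; split=> [stA x y z | st_id x y z]; apply/eqP.
  by rewrite -subr_eq0 -(star_associator hM) subr_eq0; apply/eqP/stA.
by rewrite -subr_eq0 (star_associator hM) subr_eq0; apply/eqP/st_id.
Qed.
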